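(* Let $c>0$, and for $\alpha\ge 0$ let $L_{\alpha,c}:\mathbb{R}\to[0,\infty)$ be the Logitron loss function. Then: (i) for every $\alpha\ge 0$, $L_{\alpha,c}$ is convex and continuous on $\mathbb{R}$; (ii) for every $\alpha>0$, $L_{\alpha,c}$ is continuously differentiable on $\mathbb{R}$; (iii) for every $\alpha\in(0.5,2)$, $L_{\alpha,c}$ is twice continuously differentiable on $\mathbb{R}$.
   Context: For $\alpha\ge 0$, $c>0$, and (when $\alpha\neq 1$) $c_\alpha=\frac{c^{1-\alpha}}{\alpha-1}$: Extended logarithm: $\ln_{1,c}(u)=\ln(u/c)$, and $\ln_{\alpha,c}(u)=\frac{1}{1-\alpha}(u^{1-\alpha}-c^{1-\alpha})$ for $\alpha\ne1$, with domain $\mathrm{dom}(\ln_{\alpha,c})=(0,\infty)$ if $\alpha\ge 1$ and $[0,\infty)$ if $0\le\alpha<1$. Extended exponential: $\exp_{1,c}(v)=c\exp(v)$, and $\exp_{\alpha,c}(v)=(c^{1-\alpha}+(1-\alpha)v)^{1/(1-\alpha)}$ for $\alpha\neq 1$, with domain $\mathrm{dom}(\exp_{\alpha,c})=\mathbb{R}$ if $\alpha=1$, $[c_\alpha,\infty)$ if $0\le\alpha<1$, and $(-\infty,c_\alpha)$ if $\alpha>1$. Extended logistic loss: $\ell_{\alpha,c}(z)=\ln_{\alpha,c}(c+\exp_{\alpha,c}(-z))$ for $z\in\mathrm{dom}(\ell_{\alpha,c})=\{z\in\mathbb{R}: -z\in\mathrm{dom}(\exp_{\alpha,c})\}$. Perceptron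 loss: $\ell_P(z)=\max(0,-z)$. Logitron loss: $L_{\alpha,c}(z)=\ell_{\alpha,c}(z)$ if $z\in\mathrm{dom}(\ell_{\alpha,c})$, and $L_{\alpha,c}(z)=\ell_P(z)$ otherwise. *)

(* Defs.v *)
From HB Require Import structures.
From mathcomp Require Import all_boot all_order all_algebra.
From mathcomp Require Import all_classical all_reals all_analysis.

Set Implicit Arguments.
Unset Strict Implicit.
Unset Printing Implicit Defensive.

Import Order.TTheory GRing.Theory Num.Theory.
Import numFieldNormedType.Exports.

Local Open Scope classical_set_scope.
Local Open Scope ring_scope.

Section Logitron.
Context {R : realType}.
Implicit Types (alpha c u v z : R).

(* Only meaningful for alpha != 1. *)
Definition c_ alpha c : R := c `^ (1 - alpha) / (alpha - 1).

Definition ext_ln_dom alpha : interval R :=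
  if 1 <= alpha then `]0, +oo[ else `[0, +oo[.

(* In the real powers below the base is nonnegative on the relevant domain, and
   it vanishes only if alpha < 1, where the exponent is positive; powR then has
   the expected value 0. *)
Definition ext_ln alpha c u : R :=
  if alpha == 1 then ln (u / c)
  else (1 - alpha)^-1 * (u `^ (1 - alpha) - c `^ (1 - alpha)).

Definition ext_exp_dom alpha c : interval R :=
  if alpha == 1 then `]-oo, +oo[
  else if alpha < 1 then `[c_ alpha c, +oo[
  else `]-oo, c_ alpha c[.

Definition ext_exp alpha c v : R :=
  if alpha == 1 then c * expR v
  else (c `^ (1 - alpha) + (1 - alpha) * v) `^ (1 / (1 - alpha)).

Definition ext_logistic_dom alpha c : {pred R} :=
  [pred z | - z \in ext_exp_dom alpha c].

Definition ext_logistic alpha c z : R :=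
  ext_ln alpha c (c + ext_exp alpha c (- z)).

Definition perceptron z : R := Num.max 0 (- z).

Definition logitron alpha c z : R :=
  if z \in ext_logistic_dom alpha c then ext_logistic alpha c z
  else perceptron z.

(* ext_ln is only evaluated inside its domain in ext_logistic. *)
Lemma ext_logistic_arg_dom alpha c z : 0 < c ->
  z \in ext_logistic_dom alpha c ->
  c + ext_exp alpha c (- z) \in ext_ln_dom alpha.
Proof.
move=> c0 _; have e0 : 0 <= ext_exp alpha c (- z).
  by rewrite /ext_exp; case: ifP => _; rewrite ?powR_ge0// mulr_ge0 ?ltW ?expR_gt0.
have p0 : 0 < c + ext_exp alpha c (- z) by rewrite ltr_pwDl.
by rewrite /ext_ln_dom; case: ifP => _; rewrite in_itv/= andbT// ltW.
Qed.

(* f is of class C^n on the whole line. The n derivatives must be required to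
   exist, since derive1n is total. *)
Definition continuously_differentiable (n : nat) (f : R -> R) : Prop :=
  (forall (k : nat) (x : R), (k < n)%N -> derivable (derive1n k f) x 1) /\
  continuous (derive1n n f).

End Logitron.

(* Main.v *)
Require Import Defs.
From HB Require Import structures.
From mathcomp Require Import all_boot all_order all_algebra.
From mathcomp Require Import all_classical all_reals all_analysis.
From mathcomp Require Import ring lra.

Set Implicit Arguments.
Unset Strict Implicit.
Unset Printing Implicit Defensive.

Import Order.TTheory GRing.Theory Num.Theory.
Import numFieldNormedType.Exports.

Local Open Scope classical_set_scope.
Local Open Scope ring_scope.

(** Put w(z) = c^(1-alpha) - (1-alpha) z, and let x_+^p be x^p for x > 0 and 0
    otherwise. Both branches of the Logitron loss are given by one formula:
    - alpha < 1: (1-alpha)^-1 ((c + T)^(1-alpha) - c^(1-alpha)), where T = w_+^r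
      and r = 1/(1-alpha); its derivative is -(T/(c+T))^alpha;
    - alpha > 1: -z + (1-alpha)^-1 w_+ ((1 + c S)^(1-alpha) - 1), where S = w_+^q
      and q = 1/(alpha-1), so that S = 1/exp_{alpha,c}(-z) on the domain; its
      derivative is -(1 + c S)^(-alpha);
    - alpha = 1: ln (1 + e^(-z)).
    Regularity at the boundary w = 0 can be read off these formulas, since x_+^p is
    continuous for p > 0 and C^1 for p > 1, while r > 2 iff alpha > 1/2 and q > 1
    iff alpha < 2. The factor w_+ is not differentiable, but a continuous function
    whose derivative off a point extends continuously to that point is
    differentiable there. The first derivatives are nondecreasing, whence
    convexity. *)

(** * One-variable calculus and truncated powers *)

Section Calculus.
Context {R : realType}.
Implicit Types (f g h : R -> R) (a b p q x y : R).

Lemma is_derive_continuous f x a : is_derive x 1 f a -> {for x, continuous f}.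
Proof. by move=> [df _]; exact/differentiable_continuous/derivable1_diffP. Qed.

(** By the mean value theorem, a difference quotient of [f] at [a] is a value of [g] at an
    intermediate point, which tends to [g a] by continuity. *)
Lemma is_derive1_removable f g a : continuous f -> {for a, continuous g} ->
  (forall x, x != a -> is_derive x 1 f (g x)) -> is_derive a 1 f (g a).
Proof.
move=> cf cg fg; apply/is_derive1_caratheodory.
(* Carathéodory's slope function: the difference quotient, completed by the expected derivative at
   [a]. *)
exists (fun x => if x == a then g a else (f x - f a) / (x - a)); split.
- move=> z; case: eqP => [->|/eqP za]; first by rewrite !subrr mulr0.
  by rewrite divfK// subr_eq0.
- apply/cvgrPdist_lt => e e0; rewrite eqxx.
  have /cvgrPdist_lt /(_ e e0) /nbhs_ballP [d /= d0 dg] := cg.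
  apply/nbhs_ballP; exists d => //= z; rewrite /ball/= => azd.
  case: eqP => [_|/eqP za]; first by rewrite subrr normr0.
  have wc i : {within i, continuous f} by apply: continuous_subspaceT.
  (* The intermediate point is no farther from [a] than [z], so the radius [d] chosen for [g] also
     serves for the quotient. *)
  have [y ay ->] : exists2 y, `|a - y| <= `|a - z| & (f z - f a) / (z - a) = g y.
    have [za'|az|E] := ltgtP z a; last by rewrite E eqxx in za.
    + have [|y + E] := @MVT _ f g _ _ za' _ (wc _);
        last rewrite in_itv/= => /andP[zy ya].
        by move=> y; rewrite in_itv/= => /andP[_ ya]; apply: fg; rewrite lt_eqF.
      exists y; first by rewrite !gtr0_norm ?subr_gt0//; lra.
      by rewrite -[f z - _]opprB E -mulrN opprB mulfK// subr_eq0.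
    + have [|y + E] := @MVT _ f g _ _ az _ (wc _);
        last rewrite in_itv/= => /andP[ay yz].
        by move=> y; rewrite in_itv/= => /andP[ay _]; apply: fg; rewrite gt_eqF.
      exists y; first by rewrite !ltr0_norm ?subr_lt0//; lra.
      by rewrite E mulfK// subr_eq0.
  by apply: dg; exact: le_lt_trans ay azd.
- by rewrite eqxx.
Qed.

(** The mean value theorem and monotonicity of [g] place the graph above each of its tangents;
    convexity follows from the tangent at the convex combination. *)
Lemma derivative_homo_convex f g : (forall x, is_derive x 1 f (g x)) ->
  {homo g : x y / x <= y} -> convex_function (E := R^o) [set: R^o] f.
Proof.
move=> fg gm t x y _ _.
have tangent a b : g a * (b - a) <= f b - f a.
  have wc i : {within i, continuous f}.
    by apply: continuous_subspaceT => z; exact: is_derive_continuous (fg z).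
  have [ab|ba|->] := ltgtP a b; last by rewrite !subrr mulr0.
  - have [z + ->] := @MVT _ f g _ _ ab (fun z _ => fg z) (wc _).
    rewrite in_itv/= => /andP[az _].
    by apply: ler_wpM2r; [rewrite subr_ge0 ltW|exact/gm/ltW].
  - have [z + E] := @MVT _ f g _ _ ba (fun z _ => fg z) (wc _).
    rewrite in_itv/= => /andP[_ za].
    rewrite -[f b - _]opprB E -mulrN opprB.
    by apply: ler_wnM2r; [rewrite subr_le0 ltW|exact/gm/ltW].
rewrite !convRE; set z : R := conv t x y.
have zE : z = t%:num * x + (1 - t%:num) * y by [].
have t0 : 0 <= t%:num by [].
have t1 : 0 <= 1 - t%:num by rewrite subr_ge0.
(* In the weighted sum the slope terms cancel, since t(x - z) + (1 - t)(y - z) = 0. *)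
have := lerD (ler_wpM2l t0 (tangent z x)) (ler_wpM2l t1 (tangent z y)).
rewrite /unstable.onem zE; set G := g _; set F := f _; nra.
Qed.

Lemma is_derive_derive1 f g : (forall x, is_derive x 1 f (g x)) -> derive1 f = g.
Proof. by move=> fg; apply/funext => x; rewrite derive1E derive_val. Qed.

Lemma is_derive_continuously_differentiable1 f g :
  (forall x, is_derive x 1 f (g x)) -> continuous g ->
  continuously_differentiable 1 f.
Proof.
move=> fg cg; split => [[|//] x _|]; first by have [] := fg x.
by rewrite derive1n1 (is_derive_derive1 fg).
Qed.

Lemma is_derive_continuously_differentiable2 f g h :
  (forall x, is_derive x 1 f (g x)) -> (forall x, is_derive x 1 g (h x)) ->
  continuous h -> continuously_differentiable 2 f.
Proof.
move=> fg gh ch; split => [[|[|//]] x _|].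
- by have [] := fg x.
- by rewrite derive1n1 (is_derive_derive1 fg); have [] := gh x.
- by rewrite derive1nS derive1n1 (is_derive_derive1 fg) (is_derive_derive1 gh).
Qed.

(* Not powR itself: powR takes the value 1 at negative arguments. *)
Definition pos_powR p x : R := if 0 < x then x `^ p else 0.

Lemma pos_powR_ge0 p x : 0 <= pos_powR p x.
Proof. by rewrite /pos_powR; case: ifP => // _; exact: powR_ge0. Qed.

Lemma pos_powRD p q x : pos_powR p x * pos_powR q x = pos_powR (p + q) x.
Proof.
rewrite /pos_powR; case: ifP => x0; last by rewrite mul0r.
by rewrite -powRD// (gt_eqF x0) implybT.
Qed.

Lemma is_derive_pos_powR_neq0 p x : x != 0 ->
  is_derive x 1 (pos_powR p) (p * pos_powR (p - 1) x).
Proof.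
rewrite neq_lt => /orP[x0|x0].
- rewrite {2}/pos_powR ltNge (ltW x0)/= mulr0.
  apply: (@near_eq_is_derive _ _ _ (cst 0)).
  near=> y; rewrite /pos_powR ltNge ifF//; apply/negbF.
  by rewrite ltW//; near: y; exact: lt_nbhsl.
- rewrite {2}/pos_powR x0; have := is_derive1_powR p x0.
  apply: near_eq_is_derive; near=> y; rewrite /pos_powR ifT//.
  by near: y; exact: lt_nbhsr.
Unshelve. all: by end_near. Qed.

Lemma pos_powR_continuous p : 0 < p -> continuous (pos_powR p).
Proof.
move=> p0 x; have [->|x0] := eqVneq x 0; last first.
  exact: is_derive_continuous (is_derive_pos_powR_neq0 p x0).
apply/left_right_continuousP; rewrite {2 4}/pos_powR ltxx; split.
- apply: cvg_near_cst; near=> y; rewrite /pos_powR ltNge ifF//; apply/negbF.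
  by rewrite ltW//; near: y; exact: nbhs_left_lt.
- apply: cvg_trans (powR_cvg0 p0); apply: near_eq_cvg.
  near=> y; rewrite /pos_powR ifT//; near: y; exact: nbhs_right_gt.
Unshelve. all: by end_near. Qed.

(** Only x = 0 needs an argument: as p - 1 > 0, the candidate derivative is continuous there and the
    point is removable. *)
Lemma is_derive_pos_powR p x : 1 < p ->
  is_derive x 1 (pos_powR p) (p * pos_powR (p - 1) x).
Proof.
move=> p1; have [->|] := eqVneq x 0; last exact: is_derive_pos_powR_neq0.
apply: (@is_derive1_removable _ (fun x => p * pos_powR (p - 1) x)).
- by apply: pos_powR_continuous; rewrite (lt_trans _ p1).
- by apply: cvgM; [exact: cvg_cst|apply: pos_powR_continuous; rewrite subr_gt0].
- by move=> y; exact: is_derive_pos_powR_neq0.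
Qed.

End Calculus.

(** * Closed formulas for the loss, its sign, and derivatives for alpha = 1 *)

Section Logitron.
Context {R : realType}.
Implicit Types (alpha c p q x y z : R) (f h : R -> R).

Lemma is_derive_powR_comp p f x a : is_derive x 1 f a -> 0 < f x ->
  is_derive x 1 (fun y => f y `^ p) (p * f x `^ (p - 1) * a).
Proof.
by move=> df f0; have := is_derive1_powR p f0 => dp; exact: is_derive1_comp.
Qed.

Lemma continuous_powR_comp p f x : 0 < f x -> {for x, continuous f} ->
  {for x, continuous (fun y => f y `^ p)}.
Proof.
move=> f0 cf; apply: (@continuous_comp _ _ _ f (fun u => u `^ p)) => //.
exact: is_derive_continuous (is_derive1_powR p f0).
Qed.

(** The w of the overview: the base of the power in [ext_exp alpha c (- z)]. For alpha different
    from 1 its sign separates the two branches of the loss. *)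
Definition ext_base alpha c z : R := c `^ (1 - alpha) - (1 - alpha) * z.

Lemma is_derive_ext_base alpha c z :
  is_derive z 1 (ext_base alpha c) (alpha - 1).
Proof.
have -> : ext_base alpha c = cst (c `^ (1 - alpha)) - (1 - alpha) \*: id.
  by apply/funext => y; rewrite /ext_base !fctE.
by apply: is_derive_eq; rewrite /GRing.scale/= mulr1 sub0r opprB.
Qed.

Lemma continuous_ext_base alpha c : continuous (ext_base alpha c).
Proof. by move=> z; exact: is_derive_continuous (is_derive_ext_base alpha c z). Qed.

Lemma continuous_pos_powR_ext_base p alpha c : 0 < p ->
  continuous (fun z => pos_powR p (ext_base alpha c z)).
Proof.
move=> p0 z; apply: (@continuous_comp _ _ _ (ext_base alpha c) (pos_powR p)).
  exact: continuous_ext_base.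
exact: pos_powR_continuous.
Qed.

Lemma is_derive_pos_powR_ext_base p alpha c z :
  (1 < p) || (ext_base alpha c z != 0) ->
  is_derive z 1 (fun z => pos_powR p (ext_base alpha c z))
    (p * (alpha - 1) * pos_powR (p - 1) (ext_base alpha c z)).
Proof.
move=> pz; rewrite mulrAC.
have dw := is_derive_ext_base alpha c z.
have dp : is_derive (ext_base alpha c z) 1 (pos_powR p)
    (p * pos_powR (p - 1) (ext_base alpha c z)).
  case/orP: pz => [p1|z0]; first exact: is_derive_pos_powR.
  exact: is_derive_pos_powR_neq0.
exact: is_derive1_comp.
Qed.

Lemma logitron1E c : 0 < c -> logitron 1 c = (fun z => ln (1 + expR (- z))).
Proof.
move=> c0; apply/funext => z.
rewrite /logitron ifT; last by rewrite inE /ext_exp_dom eqxx in_itv.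
rewrite /ext_logistic /ext_ln /ext_exp eqxx; congr ln.
by field; rewrite gt_eqF.
Qed.

(** The domain is w >= 0. Outside it T = 0, so the formula gives 0; there z > 0, and the perceptron
    loss is 0 too. *)
Lemma logitron_lt1E alpha c : 0 < c -> alpha < 1 ->
  logitron alpha c = (fun z => (1 - alpha)^-1 *
    ((c + pos_powR (1 - alpha)^-1 (ext_base alpha c z)) `^ (1 - alpha)
     - c `^ (1 - alpha))).
Proof.
move=> c0 a1; apply/funext => z; have b0 : 0 < 1 - alpha by rewrite subr_gt0.
have an1 : (alpha == 1) = false by rewrite lt_eqF.
have domE : (z \in ext_logistic_dom alpha c) = (0 <= ext_base alpha c z).
  rewrite inE /ext_exp_dom an1 a1 in_itv/= andbT /c_ /ext_base.
  rewrite -[alpha - 1]opprB invrN mulrN lerN2 ler_pdivlMr//.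
  by rewrite subr_ge0 mulrC.
rewrite /logitron domE /pos_powR; case: ltgtP => w0.
- by rewrite /ext_logistic /ext_ln /ext_exp an1 mulrN -/(ext_base alpha c z) div1r.
- rewrite addr0 subrr mulr0 /perceptron; apply/max_idPl.
  have : 0 < (1 - alpha) * z.
    by apply: le_lt_trans (powR_ge0 c (1 - alpha)) _; rewrite -subr_lt0.
  by rewrite pmulr_rgt0// oppr_le0 => /ltW.
(* The boundary w = 0 lies in the domain; the truncated power agrees with [powR] there because 0 to
   a nonzero exponent is 0. *)
- rewrite /ext_logistic /ext_ln /ext_exp an1 mulrN -/(ext_base alpha c z).
  by rewrite -w0 powR0// div1r invr_neq0// gt_eqF.
Qed.

(** The domain is w > 0. There c + 1/S = (1 + cS)/S and S^(alpha-1) = w, so w factors out of the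
    power; splitting off (w - c^(1-alpha))/(1-alpha) = -z leaves a formula without 1/S, which blows
    up at the boundary. Outside the domain z < 0 and both sides are -z. *)
Lemma logitron_gt1E alpha c : 0 < c -> 1 < alpha ->
  logitron alpha c = (fun z => - z + (1 - alpha)^-1 *
    (pos_powR 1 (ext_base alpha c z) *
     ((1 + c * pos_powR (alpha - 1)^-1 (ext_base alpha c z)) `^ (1 - alpha) - 1))).
Proof.
move=> c0 a1; apply/funext => z; have b0 : 0 < alpha - 1 by rewrite subr_gt0.
have an1 : (alpha == 1) = false by rewrite gt_eqF.
have bN0 : 1 - alpha != 0 by rewrite lt_eqF// subr_lt0.
have C0 : 0 < c `^ (1 - alpha) by exact: powR_gt0.
have domE : (z \in ext_logistic_dom alpha c) = (0 < ext_base alpha c z).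
  rewrite inE /ext_exp_dom an1 ltNge (ltW a1)/= in_itv/= /c_ /ext_base.
  by rewrite ltr_pdivlMr// -subr_gt0; congr (_ < _); ring.
rewrite /logitron domE /pos_powR; case: ltP => w0; last first.
  rewrite mul0r mulr0 addr0 /perceptron; apply/max_idPr.
  by move: w0; rewrite /ext_base; nra.
rewrite /ext_logistic /ext_ln /ext_exp an1 mulrN -/(ext_base alpha c z).
set w := ext_base alpha c z in w0 *; set S := w `^ (alpha - 1)^-1.
have S0 : 0 < S by exact: powR_gt0.
have -> : w `^ (1 / (1 - alpha)) = S^-1.
  by rewrite /S -powRN; congr (_ `^ _); rewrite div1r -invrN opprB.
have -> : c + S^-1 = S^-1 * (1 + c * S) by field; rewrite gt_eqF.
rewrite powRM ?invr_ge0 ?ltW//; last by rewrite addr_gt0// mulr_gt0.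
have -> : S^-1 `^ (1 - alpha) = w.
  rewrite -powR_inv1 ?ltW// /S -!powRrM -[RHS]powRr1 ?ltW//; congr (_ `^ _).
  by field; rewrite gt_eqF.
rewrite powRr1 ?ltW//; move: (_ `^ _) => X.
by rewrite /w /ext_base; field.
Qed.


Lemma is_derive_add_cst k f x a : is_derive x 1 f a ->
  is_derive x 1 (fun y => k + f y) a.
Proof.
move=> df; have := is_deriveD (is_derive_cst k x 1) df.
by rewrite add0r.
Qed.

Lemma is_derive_mul_cst k f x a : is_derive x 1 f a ->
  is_derive x 1 (fun y => k * f y) (k * a).
Proof. by move=> df; exact: is_deriveZ. Qed.

Lemma is_derive_opp f x a : is_derive x 1 f a ->
  is_derive x 1 (fun y => - f y) (- a).
Proof. by move=> df; exact: is_deriveN. Qed.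

Lemma is_derive_mul f h x a b : is_derive x 1 f a -> is_derive x 1 h b ->
  is_derive x 1 (fun y => f y * h y) (f x * b + h x * a).
Proof. by move=> df dh; exact: is_deriveM. Qed.

Lemma pos_powR_homo p : 0 <= p -> {homo (@pos_powR R p) : x y / x <= y}.
Proof.
move=> p0 x y xy; rewrite /pos_powR; case: ifPn => x0; last first.
  by case: ifP => // _; exact: powR_ge0.
have y0 := lt_le_trans x0 xy.
by rewrite y0 ge0_ler_powR// nnegrE ltW.
Qed.

Lemma le0_ger_powR p x y : p <= 0 -> 0 < x -> x <= y -> y `^ p <= x `^ p.
Proof.
move=> p0 x0 xy; have y0 := lt_le_trans x0 xy.
rewrite -[p]opprK ![_ `^ (- - p)]powRN lef_pV2 ?posrE ?powR_gt0//.
by rewrite ge0_ler_powR ?oppr_ge0// nnegrE ltW.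
Qed.

Lemma ext_exp_ge0 alpha c x : 0 < c -> 0 <= ext_exp alpha c x.
Proof.
move=> c0; rewrite /ext_exp; case: ifP => _; last exact: powR_ge0.
by rewrite mulr_ge0 ?ltW// expR_gt0.
Qed.

(** On the domain the extended logarithm is taken at a point not below c; it is increasing and
    vanishes at c. *)
Lemma logitron_ge0 alpha c z : 0 < c -> 0 <= logitron alpha c z.
Proof.
move=> c0; rewrite /logitron /perceptron; case: ifP => _;
  last by rewrite le_max lexx.
rewrite /ext_logistic; have e0 := ext_exp_ge0 alpha (- z) c0.
move: (ext_exp _ _ _) e0 => e e0.
rewrite /ext_ln; case: ifPn => [_|].
  by rewrite ln_ge0// ler_pdivlMr// mul1r lerDl.
rewrite neq_lt => /orP[a1|a1].
  rewrite mulr_ge0 ?invr_ge0 ?subr_ge0 ?(ltW a1)//.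
  rewrite ge0_ler_powR ?subr_ge0 ?(ltW a1) ?nnegrE ?lerDl ?(ltW c0)//.
  by rewrite addr_ge0// ltW.
rewrite mulr_le0 ?invr_le0 ?subr_le0 ?(ltW a1)//.
by rewrite le0_ger_powR ?subr_le0 ?(ltW a1) ?lerDl.
Qed.

(** The derivative for alpha = 1, with e^(-z)/(1 + e^(-z)) rewritten so that a single exponential
    remains. *)
Definition softplus' z : R := - (1 + expR z)^-1.

Lemma is_derive_softplus z :
  is_derive z 1 (fun y => ln (1 + expR (- y))) (softplus' z).
Proof.
have de : is_derive z 1 (fun y => 1 + expR (- y)) (expR (- z) * (- 1)).
  by apply: is_derive_add_cst; exact: is_derive1_comp.
have p0 : 0 < 1 + expR (- z) by rewrite addr_gt0// expR_gt0.
have dl := is_derive1_ln p0.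
have := @is_derive1_comp _ (@ln R) (fun y => 1 + expR (- y)) z _ _ dl de.
suff -> : (1 + expR (- z))^-1 * (expR (- z) * -1) = softplus' z by [].
rewrite /softplus' expRN; have := expR_gt0 z; move: (expR z) => e e0.
by field; rewrite !gt_eqF ?addr_gt0.
Qed.

(** The logistic differential equation: the second derivative is a polynomial in the first, hence
    continuous as soon as the first is. *)
Lemma is_derive_softplus' z :
  is_derive z 1 softplus' (- softplus' z - softplus' z * softplus' z).
Proof.
have p0 : 1 + expR z != 0 by rewrite gt_eqF// addr_gt0// expR_gt0.
have de := is_derive_add_cst 1 (is_derive_expR z).
have := is_derive_opp (@is_deriveV _ (fun y => 1 + expR y) z _ _ p0 de).
suff -> : - ((- (1 + expR z) ^- 2) *: expR z) =
  - softplus' z - softplus' z * softplus' z by [].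
by rewrite /softplus' /GRing.scale/=; field.
Qed.

Lemma softplus'_homo : {homo softplus' : x y / x <= y}.
Proof.
move=> x y xy; rewrite /softplus' lerN2 lef_pV2 ?posrE ?addr_gt0 ?expR_gt0//.
by rewrite lerD2l ler_expR.
Qed.

End Logitron.

(** * The case alpha < 1 *)

Section LogitronLt1.
Context {R : realType}.
Context (alpha c : R).
Context (c0 : 0 < c) (a1 : alpha < 1).
Implicit Types (x y z : R).

Let r := (1 - alpha)^-1.
Let w := ext_base alpha c.
Let T z := pos_powR r (w z).

Let b0 : 0 < 1 - alpha. Proof. by rewrite subr_gt0. Qed.
Let r0 : 0 < r. Proof. by rewrite invr_gt0. Qed.
Let T_ge0 z : 0 <= T z. Proof. exact: pos_powR_ge0. Qed.
Let cT_gt0 z : 0 < c + T z. Proof. by rewrite ltr_pwDl. Qed.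
Let T_continuous : continuous T. Proof. exact: continuous_pos_powR_ext_base. Qed.

(** Read off the closed formula and not from a derivative, so as to include alpha = 0, where the
    loss has a kink at w = 0. *)
Lemma logitron_lt1_continuous : continuous (logitron alpha c).
Proof.
rewrite logitron_lt1E// => z; apply: cvgM; first exact: cvg_cst.
apply: cvgB; last exact: cvg_cst.
apply: (@continuous_powR_comp _ _ (fun y => c + T y)) => //.
by apply: cvgD; [exact: cvg_cst|exact: T_continuous].
Qed.

Definition logitron_lt1' z := - ((c + T z) `^ (- alpha) * pos_powR (r - 1) (w z)).

(** Since r - 1 = alpha r, the truncated power is T^alpha. The product form suits differentiation,
    this quotient form suits monotonicity. *)
Lemma logitron_lt1'E z : 0 < alpha ->
  logitron_lt1' z = - (T z / (c + T z)) `^ alpha.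
Proof.
move=> ap; have cTV0 : 0 <= (c + T z)^-1 by rewrite invr_ge0 ltW.
rewrite /logitron_lt1' powRM// mulrC; congr (- (_ * _)).
  (* For w <= 0 the claim is 0 = 0^alpha, which needs alpha nonzero because [powR] gives 0^0 = 1. *)
  rewrite /T /pos_powR; case: ifP => _; last by rewrite powR0// gt_eqF.
  by rewrite -powRrM /r; congr (_ `^ _); field; rewrite gt_eqF.
by rewrite -powR_inv1 ?ltW// -powRrM mulN1r.
Qed.

(** T decreases in z, while t/(c + t) increases in t >= 0; the outer minus sign reverses the
    order. *)
Lemma logitron_lt1'_homo : 0 < alpha -> {homo logitron_lt1' : x y / x <= y}.
Proof.
move=> ap x y xy; rewrite !logitron_lt1'E// lerN2.
rewrite ge0_ler_powR ?(ltW ap) ?nnegrE ?divr_ge0 ?(ltW (cT_gt0 _))//.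
have Txy : T y <= T x.
  by apply: pos_powR_homo; [exact: ltW|rewrite lerB// ler_pM2l].
rewrite ler_pdivrMr// mulrAC ler_pdivlMr// !mulrDr lerD//; last by rewrite mulrC.
by rewrite ler_pM2r.
Qed.

Let is_derive_T z : 0 < alpha -> is_derive z 1 T (- pos_powR (r - 1) (w z)).
Proof.
move=> ap; have r1 : 1 < r by rewrite invf_gt1// gtrBl.
have := @is_derive_pos_powR_ext_base _ r alpha c z; rewrite r1 => /(_ isT).
suff -> : r * (alpha - 1) = -1 by rewrite mulN1r.
by rewrite /r; field; rewrite gt_eqF.
Qed.

Lemma is_derive_logitron_lt1 z : 0 < alpha ->
  is_derive z 1 (logitron alpha c) (logitron_lt1' z).
Proof.
move=> ap; rewrite logitron_lt1E//.
have := is_derive_powR_comp (1 - alpha)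
  (is_derive_add_cst c (is_derive_T z ap)) (cT_gt0 z).
move=> /(is_derive_add_cst (- c `^ (1 - alpha))) /(is_derive_mul_cst r) d.
have -> : logitron_lt1' z = r * ((1 - alpha) * (c + T z) `^ (1 - alpha - 1) *
    (- pos_powR (r - 1) (w z))).
  rewrite /logitron_lt1' (_ : 1 - alpha - 1 = - alpha); last by ring.
  by rewrite /r; field; rewrite gt_eqF.
suff <- : (fun z => r * (- c `^ (1 - alpha) + (c + T z) `^ (1 - alpha))) =
  (fun z => r * ((c + T z) `^ (1 - alpha) - c `^ (1 - alpha))) by [].
by apply/funext => y; rewrite addrC.
Qed.

Lemma logitron_lt1'_continuous : 0 < alpha -> continuous logitron_lt1'.
Proof.
move=> ap z; apply: cvgN; apply: cvgM.
  apply: (@continuous_powR_comp _ _ (fun y => c + T y)) => //.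
  by apply: cvgD; [exact: cvg_cst|exact: T_continuous].
by apply: continuous_pos_powR_ext_base; rewrite subr_gt0 invf_gt1// gtrBl.
Qed.

Definition logitron_lt1'' z :=
  alpha * c * ((c + T z) `^ (- alpha - 1) * pos_powR (r - 2) (w z)).

Let r_gt2 : 1 / 2 < alpha -> 2 < r.
Proof.
move=> ah; rewrite -[2]invrK ltf_pV2 ?posrE ?invr_gt0//.
by move: ah; rewrite div1r; lra.
Qed.

(** The product rule leaves alpha (c+T)^(-alpha-1) times (c+T) w_+^(r-2) - w_+^(2r-2). The last
    power is T w_+^(r-2), so only c w_+^(r-2) survives. *)
Lemma is_derive_logitron_lt1' z : 1 / 2 < alpha ->
  is_derive z 1 logitron_lt1' (logitron_lt1'' z).
Proof.
move=> ah; have ap : 0 < alpha by apply: lt_trans ah; rewrite divr_gt0.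
have r2 := r_gt2 ah.
have dX := is_derive_powR_comp (- alpha)
  (is_derive_add_cst c (is_derive_T z ap)) (cT_gt0 z).
have dP : is_derive z 1 (fun y => pos_powR (r - 1) (w y))
    ((r - 1) * (alpha - 1) * pos_powR (r - 1 - 1) (w z)).
  by apply: is_derive_pos_powR_ext_base; rewrite ltrBrDr r2.
have := is_derive_opp (is_derive_mul dX dP).
congr (is_derive _ _ _ _).
rewrite /logitron_lt1''.
have -> : (r - 1) * (alpha - 1) = - alpha.
  by rewrite /r; field; rewrite gt_eqF.
have -> : r - 1 - 1 = r - 2 by ring.
have -> : (c + T z) `^ (- alpha) = (c + T z) * (c + T z) `^ (- alpha - 1).
  rewrite -{2}[c + T z]powRr1 ?ltW// -powRD; first by congr (_ `^ _); ring.
  by rewrite (gt_eqF (cT_gt0 z)) implybT.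
have PP : pos_powR (r - 1) (w z) * pos_powR (r - 1) (w z) =
    T z * pos_powR (r - 2) (w z).
  by rewrite !pos_powRD; congr (pos_powR _ _); ring.
move: PP; move: (pos_powR (r - 1) _) (pos_powR (r - 2) _) (_ `^ _) => P1 P2 X PP.
rewrite mulrN mulrA mulrCA.
transitivity (alpha * X * ((c + T z) * P2 - P1 * P1)); first by ring.
by rewrite PP; ring.
Qed.

Lemma logitron_lt1''_continuous : 1 / 2 < alpha -> continuous logitron_lt1''.
Proof.
move=> ah z; apply: cvgM; first exact: cvg_cst.
apply: cvgM; last first.
  by apply: continuous_pos_powR_ext_base; rewrite subr_gt0 r_gt2.
apply: (@continuous_powR_comp _ _ (fun y => c + T y)) => //.
by apply: cvgD; [exact: cvg_cst|exact: T_continuous].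
Qed.

End LogitronLt1.

(** * The case alpha > 1 *)

Section LogitronGt1.
Context {R : realType}.
Context (alpha c : R).
Context (c0 : 0 < c) (a1 : 1 < alpha).
Implicit Types (x y z : R).

Let q := (alpha - 1)^-1.
Let w := ext_base alpha c.
Let S z := pos_powR q (w z).

Let b0 : 0 < alpha - 1. Proof. by rewrite subr_gt0. Qed.
Let q0 : 0 < q. Proof. by rewrite invr_gt0. Qed.
Let cS_gt0 z : 0 < 1 + c * S z.
Proof. by apply: ltr_pwDl => //; rewrite pmulr_rge0//; exact: pos_powR_ge0. Qed.

Let cS_continuous : continuous (fun z => 1 + c * S z).
Proof.
move=> z; apply: cvgD; first exact: cvg_cst.
by apply: cvgM; [exact: cvg_cst|exact: continuous_pos_powR_ext_base].
Qed.

(** Needed before differentiability: removing the exceptional point w = 0 requires a continuous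
    loss. *)
Lemma logitron_gt1_continuous : continuous (logitron alpha c).
Proof.
rewrite logitron_gt1E// => z; apply: cvgD; first by apply: cvgN; exact: cvg_id.
apply: cvgM; first exact: cvg_cst.
apply: cvgM; first exact: continuous_pos_powR_ext_base.
apply: cvgB; last exact: cvg_cst.
apply: (@continuous_powR_comp _ _ (fun y => 1 + c * S y)).
  exact: cS_gt0.
exact: cS_continuous.
Qed.

Definition logitron_gt1' z := - (1 + c * S z) `^ (- alpha).

(** Here w has positive slope, so S increases, and the negative exponent and the minus sign reverse
    the order twice. *)
Lemma logitron_gt1'_homo : {homo logitron_gt1' : x y / x <= y}.
Proof.
move=> x y xy; rewrite lerN2 le0_ger_powR//.
  by rewrite oppr_le0 ltW// (lt_trans _ a1).
rewrite lerD2l ler_pM2l//; apply: pos_powR_homo; first exact: ltW.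
by rewrite lerD2l lerN2 ler_nM2l// subr_lt0.
Qed.

Lemma logitron_gt1'_continuous : continuous logitron_gt1'.
Proof.
move=> z; apply: cvgN.
apply: (@continuous_powR_comp _ _ (fun y => 1 + c * S y)).
  exact: cS_gt0.
exact: cS_continuous.
Qed.

Let is_derive_cS z : (1 < q) || (w z != 0) ->
  is_derive z 1 (fun y => 1 + c * S y) (c * pos_powR (q - 1) (w z)).
Proof.
move=> /is_derive_pos_powR_ext_base.
have -> : q * (alpha - 1) = 1 by rewrite /q; field; rewrite gt_eqF.
by rewrite mul1r => /(is_derive_mul_cst c) /(is_derive_add_cst 1).
Qed.

Let is_derive_logitron_gt1_neq0 z : w z != 0 ->
  is_derive z 1 (logitron alpha c) (logitron_gt1' z).
Proof.
move=> wz; rewrite logitron_gt1E//.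
have dS : is_derive z 1 (fun y => 1 + c * S y) (c * pos_powR (q - 1) (w z)).
  by apply: is_derive_cS; rewrite wz orbT.
have dA : is_derive z 1 (fun y => pos_powR 1 (w y))
    (1 * (alpha - 1) * pos_powR (1 - 1) (w z)).
  by apply: is_derive_pos_powR_ext_base; rewrite wz orbT.
have dB := is_derive_add_cst (- 1)
  (is_derive_powR_comp (1 - alpha) dS (cS_gt0 z)).
have dAB := is_derive_mul_cst (1 - alpha)^-1 (is_derive_mul dA dB).
have := is_deriveD (is_derive_opp (is_derive_id z 1)) dAB.
have -> : (fun y => - y) + (fun y => (1 - alpha)^-1 *
    (pos_powR 1 (w y) * (- 1 + (1 + c * S y) `^ (1 - alpha)))) =
  (fun y => - y + (1 - alpha)^-1 *
    (pos_powR 1 (w y) * ((1 + c * S y) `^ (1 - alpha) - 1))).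
  by apply/funext => y; rewrite !fctE [-1 + _]addrC.
congr (is_derive _ _ _ _); rewrite /logitron_gt1'.
have -> : 1 - alpha - 1 = - alpha by ring.
have -> : 1 - 1 = 0 :> R by ring.
have P0 : pos_powR 0 (w z) * (- 1 + (1 + c * S z) `^ (1 - alpha)) =
    - 1 + (1 + c * S z) `^ (1 - alpha).
  rewrite /S /pos_powR; case: ifP => _; first by rewrite powRr0 mul1r.
  by rewrite mulr0 addr0 powR1 addNr mulr0.
have P1 : pos_powR 1 (w z) * pos_powR (q - 1) (w z) = S z.
  by rewrite pos_powRD; congr (pos_powR _ _); ring.
have XE : (1 + c * S z) `^ (1 - alpha) = (1 + c * S z) * (1 + c * S z) `^ (- alpha).
  rewrite -{2}[1 + c * S z]powRr1 ?ltW// -powRD//.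
  by rewrite (gt_eqF (cS_gt0 z)) implybT.
rewrite XE in P0 *; move: (_ `^ (- alpha)) P0 => X P0.
move: (pos_powR 0 _) (pos_powR 1 _) (pos_powR (q - 1) _) P0 P1 => A0 A1 Q P0 P1.
transitivity (- 1 + A1 * Q * c * X - A0 * (-1 + (1 + c * S z) * X)).
  by field; rewrite lt_eqF// subr_lt0.
by rewrite P0 P1; ring.
Qed.

Lemma is_derive_logitron_gt1 z :
  is_derive z 1 (logitron alpha c) (logitron_gt1' z).
Proof.
have [wz|] := eqVneq (w z) 0; last exact: is_derive_logitron_gt1_neq0.
apply: is_derive1_removable.
- exact: logitron_gt1_continuous.
- exact: logitron_gt1'_continuous.
- move=> x xz; apply: is_derive_logitron_gt1_neq0; apply: contra_neq xz => wx.
  (* w is affine with nonzero slope, so z is its only zero. *)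
  have : (alpha - 1) * (x - z) = w x - w z by rewrite /w /ext_base; ring.
  move/eqP; rewrite wx wz subrr mulf_eq0 gt_eqF//= subr_eq0.
  by move/eqP.
Qed.

Definition logitron_gt1'' z :=
  alpha * c * ((1 + c * S z) `^ (- alpha - 1) * pos_powR (q - 1) (w z)).

Let q_gt1 : alpha < 2 -> 1 < q.
Proof. by move=> a2; rewrite invf_gt1// ltrBlDr. Qed.

(** Unlike the loss, its derivative involves w only through S, so for q > 1 the chain rule also
    covers w = 0. *)
Lemma is_derive_logitron_gt1' z : alpha < 2 ->
  is_derive z 1 logitron_gt1' (logitron_gt1'' z).
Proof.
move=> a2.
have dS : is_derive z 1 (fun y => 1 + c * S y) (c * pos_powR (q - 1) (w z)).
  by apply: is_derive_cS; rewrite q_gt1.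
have := is_derive_opp (is_derive_powR_comp (- alpha) dS (cS_gt0 z)).
congr (is_derive _ _ _ _); rewrite /logitron_gt1''.
move: (_ `^ _) (pos_powR _ _) => X Q; ring.
Qed.

Lemma logitron_gt1''_continuous : alpha < 2 -> continuous logitron_gt1''.
Proof.
move=> a2 z; apply: cvgM; first exact: cvg_cst.
apply: cvgM; last first.
  by apply: continuous_pos_powR_ext_base; rewrite subr_gt0 q_gt1.
apply: (@continuous_powR_comp _ _ (fun y => 1 + c * S y)).
  exact: cS_gt0.
exact: cS_continuous.
Qed.

End LogitronGt1.

(** For alpha = 0 the loss is the hinge max(0, c - z), convex as a maximum of affine functions; no
    derivative is available at z = c. *)
Lemma logitron0_convex (R : realType) (c : R) : 0 < c ->
  convex_function (E := R^o) [set: R^o] (logitron 0 c).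
Proof.
move=> c0.
have LE z : logitron 0 c z = pos_powR 1 (c - z).
  rewrite logitron_lt1E// /ext_base subr0 invr1 !mul1r (powRr1 (ltW c0)).
  have cP0 : 0 <= c + pos_powR 1 (c - z) by rewrite addr_ge0 ?pos_powR_ge0// ltW.
  by rewrite powRr1// addrC addKr.
have PE x : pos_powR 1 x = Num.max 0 x.
  by rewrite /pos_powR maxElt; case: ltP => // x0; rewrite powRr1// ltW.
move=> t x y _ _; rewrite !convRE !LE !PE ge_max.
have t0 : 0 <= t%:num by [].
have t1 : 0 <= unstable.onem t%:num by rewrite subr_ge0.
have xE : conv t x y = t%:num * x + unstable.onem t%:num * y by [].
have mx : c - x <= Num.max 0 (c - x) by rewrite le_max lexx orbT.
have my : c - y <= Num.max 0 (c - y) by rewrite le_max lexx orbT.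
apply/andP; split; first by rewrite addr_ge0// mulr_ge0// le_max lexx.
apply: le_trans (lerD (ler_wpM2l t0 mx) (ler_wpM2l t1 my)).
by rewrite xE /unstable.onem le_eqVlt; apply/orP; left; apply/eqP; ring.
Qed.

(** * Assembly of the cases *)

Theorem mainTheorem1 (R : realType) (c : R) (hc : 0 < c) :
  (forall alpha z : R, 0 <= alpha -> 0 <= logitron alpha c z) /\
  (forall alpha : R, 0 <= alpha ->
     convex_function (E := R^o) [set: R^o] (logitron alpha c) /\
     continuous (logitron alpha c)) /\
  (forall alpha : R, 0 < alpha ->
     continuously_differentiable 1 (logitron alpha c)) /\
  (forall alpha : R, 1 / 2 < alpha -> alpha < 2 ->
     continuously_differentiable 2 (logitron alpha c)).
Proof.
(* A monotone continuous derivative, itself differentiable with continuous derivative for alpha in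
   (1/2, 2), yields all the convexity and smoothness claims for alpha > 0. *)
have C1 (alpha : R) : 0 < alpha -> exists g : R -> R,
    [/\ forall z : R, is_derive z 1 (logitron alpha c) (g z),
        {homo g : x y / x <= y}, continuous g &
        1 / 2 < alpha -> alpha < 2 -> exists2 h : R -> R,
          forall z : R, is_derive z 1 g (h z) & continuous h].
  move=> ap; have [a1|a1|->] := ltgtP alpha 1.
  - exists (logitron_lt1' alpha c); split => [z|||ah _].
    + exact: is_derive_logitron_lt1.
    + exact: logitron_lt1'_homo.
    + exact: logitron_lt1'_continuous.
    + exists (logitron_lt1'' alpha c); last exact: logitron_lt1''_continuous.
      by move=> z; exact: is_derive_logitron_lt1'.
  - exists (logitron_gt1' alpha c); split => [z|||_ a2].
    + exact: is_derive_logitron_gt1.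
    + exact: logitron_gt1'_homo.
    + exact: logitron_gt1'_continuous.
    + exists (logitron_gt1'' alpha c); last exact: logitron_gt1''_continuous.
      by move=> z; exact: is_derive_logitron_gt1'.
  - have cs : continuous (@softplus' R).
      by move=> z; exact: is_derive_continuous (is_derive_softplus' z).
    exists (@softplus' R); split => [z||//|_ _].
    + by rewrite logitron1E//; exact: is_derive_softplus.
    + exact: softplus'_homo.
    + exists (fun z => - softplus' z - softplus' z * softplus' z).
        exact: is_derive_softplus'.
      by move=> z; apply: cvgB; [apply: cvgN; exact: cs|apply: cvgM; exact: cs].
split; first by move=> alpha z _; exact: logitron_ge0.
split; [move=> alpha|split => alpha].
- rewrite le_eqVlt => /predU1P[<-|ap].
    by split; [exact: logitron0_convex|exact: logitron_lt1_continuous].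
  have [g [dg gm _ _]] := C1 _ ap; split; first exact: derivative_homo_convex dg gm.
  by move=> z; exact: is_derive_continuous (dg z).
- move=> ap; have [g [dg _ cg _]] := C1 _ ap.
  exact: is_derive_continuously_differentiable1 dg cg.
- move=> ah a2; have ap : 0 < alpha by apply: lt_trans ah; rewrite divr_gt0.
  have [g [dg _ _ /(_ ah a2)[h dh ch]]] := C1 _ ap.
  exact: is_derive_continuously_differentiable2 dg dh ch.
Qed.
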